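(* Let $k,p$ be positive real numbers, $n,q\in\mathbb{N}$ with $n,q\ge1$, and $x\in\mathbb{C}\setminus k\mathbb{Z}^{-}$ with $\mathrm{Re}(x)>0$. Then $${}_{p}(x)_{n,k}=\left(\frac{p}{k}\right)^{n}(x)_{n,k}=p^{n}\left(\frac{x}{k}\right)_{n},$$ and $${}_{p}(x)_{nq,k}=\left(\frac{p}{k}\right)^{nq}(x)_{nq,k}=p^{nq}\left(\frac{x}{k}\right)_{nq}=(pq)^{nq}\prod_{r=1}^{q}\left(\frac{\frac{x}{k}+r-1}{q}\right)_{n}.$$
   Context: $\mathbb{Z}^-$ is the set of negative integers. The p-k Pochhammer symbol is ${}_{p}(x)_{n,k}=\left(\frac{xp}{k}\right)\left(\frac{xp}{k}+p\right)\cdots\left(\frac{xp}{k}+(n-1)p\right)$; the k-Pochhammer symbol is $(x)_{n,k}=x(x+k)\cdots(x+(n-1)k)$; the classical Pochhammer symbol is $(x)_n=x(x+1)\cdots(x+n-1)$. *)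

(* Defs.v *)
From HB Require Import structures.
From mathcomp Require Import all_boot all_order all_algebra.
From mathcomp Require Import reals.
From mathcomp Require Import complex.

Set Implicit Arguments.
Unset Strict Implicit.
Unset Printing Implicit Defensive.

Import Order.TTheory GRing.Theory Num.Theory.

Local Open Scope ring_scope.

Definition pochhammer (F : fieldType) (x : F) (n : nat) : F :=
  \prod_(i < n) (x + i%:R).

Definition k_pochhammer (F : fieldType) (k x : F) (n : nat) : F :=
  \prod_(i < n) (x + i%:R * k).

Definition pk_pochhammer (F : fieldType) (p k x : F) (n : nat) : F :=
  \prod_(i < n) (x * p / k + i%:R * p).

(* Main.v *)
Require Import Defs.
From HB Require Import structures.
From mathcomp Require Import all_boot all_order all_algebra.
From mathcomp Require Import reals.
From mathcomp Require Import complex.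
From mathcomp Require Import ring.

Set Implicit Arguments.
Unset Strict Implicit.
Unset Printing Implicit Defensive.

Import Order.TTheory GRing.Theory Num.Theory.

Local Open Scope ring_scope.
Local Open Scope complex_scope.

Section Pochhammer.
Variable F : fieldType.
Implicit Types (k p x y : F) (n q : nat).

(** The first equalities hold factor by factor: [x * p / k + i * p = (p / k) * (x + i * k)] and
    [x + i * k = k * (x / k + i)], so one constant comes out of each factor. The last one is the
    multiplication formula [pochhammer_mul]: the [n * q] factors [y + j] are sorted by the residue
    of [j] modulo [q], and [y + i + m * q = q * ((y + i) / q + m)]. *)

Lemma pk_pochhammerE p k x n :
  k != 0 -> pk_pochhammer p k x n = (p / k) ^+ n * k_pochhammer k x n.
Proof.
(* The power becomes a constant product over ['I_n], so that both sides can be compared factor by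
   factor. *)
move=> k0; rewrite -[n in _ ^+ n]card_ord -prodr_const -big_split /=.
by apply: eq_bigr => i _; field.
Qed.

Lemma k_pochhammerE k x n :
  k != 0 -> k_pochhammer k x n = k ^+ n * pochhammer (x / k) n.
Proof.
move=> k0; rewrite -[n in _ ^+ n]card_ord -prodr_const -big_split /=.
by apply: eq_bigr => i _; field.
Qed.

Lemma pochhammerD y m n :
  pochhammer y (m + n) = pochhammer y m * pochhammer (y + m%:R) n.
Proof.
rewrite /pochhammer big_split_ord /=; congr (_ * _).
by apply: eq_bigr => i _; rewrite natrD addrA.
Qed.

Lemma pochhammerSr y n : pochhammer y n.+1 = pochhammer y n * (y + n%:R).
Proof. by rewrite /pochhammer big_ord_recr. Qed.

(** Induction on [n]: one more step appends a block of [q] consecutive factors, which contains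
    exactly one new factor for each residue class modulo [q]. *)
Lemma pochhammer_mul y n q : q%:R != 0 :> F ->
  pochhammer y (n * q)
  = q%:R ^+ (n * q) * \prod_(i < q) pochhammer ((y + i%:R) / q%:R) n.
Proof.
move=> q0; elim: n => [|n IHn].
  by rewrite mul0n expr0 mul1r big1 /pochhammer ?big_ord0 // => i _; rewrite big_ord0.
rewrite mulSnr pochhammerD IHn exprD -!mulrA; congr (_ * _).
under [in RHS]eq_bigr => i _ do rewrite pochhammerSr.
rewrite big_split /= mulrCA; congr (_ * _).
(* The remaining [q ^+ q] gives one [q] to each new factor:
   [q * ((y + i) / q + n) = y + n * q + i]. *)
rewrite -[q in _ ^+ q]card_ord -prodr_const -big_split /=.
by apply: eq_bigr => i _; rewrite natrM; field.
Qed.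

End Pochhammer.

Theorem theorem2p10 (R : realType) (k p : R) (n q : nat) (x : R[i])
    (k_gt0 : 0 < k) (p_gt0 : 0 < p) (n_ge1 : (1 <= n)%N) (q_ge1 : (1 <= q)%N)
    (x_notin_kZneg : forall m : int, m < 0 -> x <> k%:C * m%:~R)
    (Rex_gt0 : 0 < complex.Re x) :
  [/\ pk_pochhammer p%:C k%:C x n
        = (p%:C / k%:C) ^+ n * k_pochhammer k%:C x n
    & (p%:C / k%:C) ^+ n * k_pochhammer k%:C x n
        = p%:C ^+ n * pochhammer (x / k%:C) n]
  /\
  [/\ pk_pochhammer p%:C k%:C x (n * q)
        = (p%:C / k%:C) ^+ (n * q) * k_pochhammer k%:C x (n * q),
      (p%:C / k%:C) ^+ (n * q) * k_pochhammer k%:C x (n * q)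
        = p%:C ^+ (n * q) * pochhammer (x / k%:C) (n * q)
    & p%:C ^+ (n * q) * pochhammer (x / k%:C) (n * q)
        = (p%:C * q%:R) ^+ (n * q)
          * \prod_(1 <= r < q.+1) pochhammer ((x / k%:C + r%:R - 1) / q%:R) n].
Proof.
have k0 : k%:C != 0 by rewrite fmorph_eq0 gt_eqF.
have q0 : q%:R != 0 :> R[i] by rewrite pnatr_eq0 -lt0n.
have k_to_1 m : (p%:C / k%:C) ^+ m * k_pochhammer k%:C x m
    = p%:C ^+ m * pochhammer (x / k%:C) m.
  by rewrite k_pochhammerE // mulrA -exprMn divfK.
do ![split]; rewrite ?pk_pochhammerE ?k_to_1 //.
rewrite pochhammer_mul // mulrA -exprMn; congr (_ * _).
(* The index shift [r = i + 1] absorbs the [- 1] in the statement. *)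
rewrite big_add1 big_mkord; apply: eq_bigr => i _.
by rewrite -natr1 addrA addrK.
Qed.
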